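(* Let $a,b,c$ be positive integers and let $\mathcal{D}=[a]\times[b]\times[c]\subset\mathbb{Z}_+^3$ be the full three-dimensional Ferrers diagram. Then the multiplicity of the special fiber ring of $I_{\mathcal{D}}$ is $$\operatorname{e}(\mathcal{F}(I_{\mathcal{D}}))=\binom{a+b+c-3}{a-1,\,b-1,\,c-1}:=\frac{(a+b+c-3)!}{(a-1)!\,(b-1)!\,(c-1)!}.$$
   Context: $\mathbb{K}$ is a field of characteristic zero, $\mathbb{Z}_+$ is the set of positive integers and $[n]=\{1,\dots,n\}$. For $\mathcal{D}=[a]\times[b]\times[c]$ let $R=\mathbb{K}[x_1,\dots,x_a,y_1,\dots,y_b,z_1,\dots,z_c]$, with graded maximal ideal $\mathfrak{m}$, and $I_{\mathcal{D}}=(x_iy_jz_k:(i,j,k)\in\mathcal{D})\subset R$. The special fiber ring (toric ring) is $\mathcal{F}(I_{\mathcal{D}})=\bigoplus_{l\ge 0}I_{\mathcal{D}}^l/\mathfrak{m}I_{\mathcal{D}}^l$. It is isomorphic to the subalgebra $\mathbb{K}[x_iy_jz_k:(i,j,k)\in\mathcal{D}]$ of $R$, standard graded so that each generator $x_iy_jz_k$ has degree $1$. For a finitely generated graded module $M\neq 0$ over a standard graded $\mathbb{K}$-algebra, with $\dim M\geq 1$, $H(M,k)=\dim_{\mathbb{K}}M_k$ agrees for $k\gg0$ with a polynomial of degree $\dim M-1$ whose leading coefficient is $\operatorname{e}(M)/(\dim M-1)!$; the positive integer $\operatorname{e}(M)$ is the multiplicity of $M$. *)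

(* Defs.v *)
From HB Require Import structures.
From mathcomp Require Import all_boot all_order all_algebra.
From mathcomp Require Import mpoly boolp.

Set Implicit Arguments.
Unset Strict Implicit.
Unset Printing Implicit Defensive.

Import GRing.Theory.
Local Open Scope ring_scope.
Local Open Scope quotient_scope.

(* Ideals are boolean predicates (through boolp), so that they can be fed to  *)
(* the sub-structure and quotient constructions of MathComp.                  *)
Section Ideals.
Variable A : comNzRingType.
Implicit Types (S I J : {pred A}).

Definition ideal_gen S : {pred A} := fun x =>
  `[< exists n (c s : 'I_n -> A),
        (forall i, s i \in S) /\ x = \sum_(i < n) c i * s i >].

Definition ideal_mul I J : {pred A} :=
  ideal_gen (fun x => `[< exists u v, [/\ u \in I, v \in J & x = u * v] >]).

Definition ideal_exp I (l : nat) : {pred A} := iter l (ideal_mul I) predT.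

(* Unlike [idealr_closed], the unit ideal is allowed. *)
Definition is_ideal J :=
  [/\ 0 \in J, {in J &, forall x y, x + y \in J}
    & forall c, {in J, forall x, c * x \in J}].

Lemma ideal_genP S x :
  reflect (exists n (c s : 'I_n -> A),
             (forall i, s i \in S) /\ x = \sum_(i < n) c i * s i)
          (x \in ideal_gen S).
Proof. exact: asboolP. Qed.

Lemma ideal_gen_is_ideal S : is_ideal (ideal_gen S).
Proof.
split.
- apply/ideal_genP; exists 0%N, (fun=> 0), (fun=> 0).
  by split; [case | rewrite big_ord0].
- move=> _ _ /ideal_genP[n [c [s [sS ->]]]] /ideal_genP[m [d [t [tS ->]]]].
  apply/ideal_genP; exists (n + m)%N.
  exists (fun i => match split i with inl j => c j | inr j => d j end).
  exists (fun i => match split i with inl j => s j | inr j => t j end).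
  split=> [i|]; first by case: (split i).
  rewrite big_split_ord /=; congr (_ + _); apply: eq_bigr => i _.
    by rewrite (unsplitK (inl i)).
  by rewrite (unsplitK (inr i)).
- move=> a _ /ideal_genP[n [c [s [sS ->]]]].
  apply/ideal_genP; exists n, (fun i => a * c i), s; split=> //.
  by rewrite mulr_sumr; apply: eq_bigr => i _; rewrite mulrA.
Qed.

Lemma mem_ideal_gen S x : x \in S -> x \in ideal_gen S.
Proof.
move=> xS; apply/ideal_genP; exists 1%N, (fun=> 1), (fun=> x).
by rewrite big_ord1 mul1r.
Qed.

Lemma ideal_gen_sub S J :
  is_ideal J -> {subset S <= J} -> {subset ideal_gen S <= J}.
Proof.
move=> [J0 JD JM] SJ _ /ideal_genP[n [c [s [sS ->]]]].
by elim/big_ind: _ => // i _; apply/JM/SJ/sS.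
Qed.

Lemma ideal_mul_is_ideal I J : is_ideal (ideal_mul I J).
Proof. exact: ideal_gen_is_ideal. Qed.

Lemma mem_ideal_mul I J u v :
  u \in I -> v \in J -> u * v \in ideal_mul I J.
Proof.
by move=> uI vJ; apply: mem_ideal_gen; apply/asboolP; exists u, v; split.
Qed.

Lemma ideal_mul_sub I J L : is_ideal L ->
  (forall u v, u \in I -> v \in J -> u * v \in L) ->
  {subset ideal_mul I J <= L}.
Proof.
move=> idL IJL; apply: ideal_gen_sub => // x /asboolP[u [v [uI vJ ->]]].
exact: IJL.
Qed.

Lemma ideal_exp_is_ideal I l : is_ideal (ideal_exp I l).
Proof. by case: l => [|l]; [split | exact: ideal_mul_is_ideal]. Qed.

Lemma ideal_transporter L w : is_ideal L -> is_ideal [pred u | u * w \in L].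
Proof.
move=> [L0 LD LM]; split; rewrite ?inE ?mul0r //.
- by move=> x y; rewrite !inE mulrDl; apply: LD.
- by move=> c x; rewrite !inE -mulrA; apply: LM.
Qed.

Lemma ideal_expM I k l u v : u \in ideal_exp I k -> v \in ideal_exp I l ->
  u * v \in ideal_exp I (k + l).
Proof.
move=> + vl; elim: k u => [|k IHk] u /=.
  by move=> _; case: (ideal_exp_is_ideal I l) => _ _; apply.
apply: (@ideal_mul_sub _ _ [pred u | u * v \in ideal_exp I (k.+1 + l)]).
  exact/ideal_transporter/ideal_exp_is_ideal.
move=> x y xI yk; rewrite inE -mulrA addSn.
exact/mem_ideal_mul/IHk.
Qed.

Lemma ideal_mul_expM m I k l u v :
    u \in ideal_mul m (ideal_exp I k) -> v \in ideal_exp I l ->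
  u * v \in ideal_mul m (ideal_exp I (k + l)).
Proof.
move=> + vl; move: u.
apply: (@ideal_mul_sub _ _ [pred u | u * v \in ideal_mul m _]).
  exact/ideal_transporter/ideal_mul_is_ideal.
by move=> x y xm yk; rewrite inE -mulrA; apply/mem_ideal_mul/ideal_expM.
Qed.

Lemma ideal_sum J (T : finType) (F : T -> A) :
  is_ideal J -> (forall i, F i \in J) -> \sum_i F i \in J.
Proof. by move=> [J0 JD _] FJ; elim/big_ind: _. Qed.

Lemma ideal_sub J x y : is_ideal J -> x \in J -> y \in J -> x - y \in J.
Proof. by move=> [_ JD JM] xJ yJ; rewrite -mulN1r; apply/JD/JM. Qed.

Definition prime_chain (n : nat) (P : nat -> {pred A}) :=
  (forall i, (i <= n)%N -> idealr_closed (P i) /\ prime_idealr_closed (P i)) /\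
  (forall i, (i < n)%N ->
     {subset P i <= P i.+1} /\ ~ {subset P i.+1 <= P i}).

Definition krull_dim (d : nat) :=
  (exists P, prime_chain d P) /\
  (forall n P, prime_chain n P -> (n <= d)%N).

End Ideals.

Section Multiplicity.
Variable K : fieldType.

Definition has_dim (V : lmodType K) (U : {pred V}) (n : nat) :=
  exists v : 'I_n -> V,
    [/\ forall i, v i \in U,
        forall c : 'I_n -> K, \sum_i c i *: v i = 0 -> forall i, c i = 0
      & {in U, forall u, exists c : 'I_n -> K, u = \sum_i c i *: v i}].

(* Multiplicity of a graded algebra A, of Krull dimension d.+1 >= 1, whose    *)
(* component of degree k is G k.                                              *)
Definition has_multiplicity (A : comAlgType K) (G : nat -> {pred A}) (e : rat) :=
  exists (d : nat) (P : {poly rat}),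
    [/\ krull_dim A d.+1,
        size P = d.+1,
        lead_coef P = e / (d`!)%:R
      & exists k0 : nat, forall k, (k0 <= k)%N ->
          exists2 h : nat, has_dim (G k) h & P.[k%:R] = h%:R].

End Multiplicity.

(* The special fiber ring of an ideal I of R = K[X_0, ..., X_(n-1)] is the    *)
(* quotient of the Rees algebra (+)_l I^l t^l, a subring of {poly R} with t   *)
(* the polynomial variable, by its ideal (+)_l m I^l t^l.                     *)
Section SpecialFiber.
Variables (K : fieldType) (n : nat).
Let R := {mpoly K[n]}.
Implicit Type I : {pred R}.

Definition max_ideal : {pred R} := ideal_gen [pred f | [exists i, f == 'X_i]].

Definition in_rees I (p : {poly R}) := `[< forall l, p`_l \in ideal_exp I l >].

Lemma in_reesP I (p : {poly R}) :
  reflect (forall l, p`_l \in ideal_exp I l) (in_rees I p).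
Proof. exact: asboolP. Qed.

Lemma in_rees_subring I : subring_closed (in_rees I).
Proof.
split.
- apply/in_reesP => l; rewrite coef1; case: l => //= l.
  by case: (ideal_exp_is_ideal I l.+1).
- move=> p q /in_reesP pI /in_reesP qI; apply/in_reesP => l; rewrite coefB.
  exact/ideal_sub/qI/pI/ideal_exp_is_ideal.
- move=> p q /in_reesP pI /in_reesP qI; apply/in_reesP => l; rewrite coefM.
  apply: ideal_sum (ideal_exp_is_ideal I l) _ => i.
  move: (pI i) (qI (l - i)%N) => /ideal_expM /[apply].
  by rewrite subnKC // leq_ord.
Qed.

HB.instance Definition _ I :=
  GRing.isSubringClosed.Build {poly R} (in_rees I) (in_rees_subring I).

Definition rees I := {p : {poly R} | in_rees I p}.

HB.instance Definition _ I := SubChoice.on (rees I).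
HB.instance Definition _ I := [SubChoice_isSubComNzRing of rees I by <:].

Definition fiber_ideal I : {pred rees I} := fun s =>
  `[< forall l, (val s)`_l \in ideal_mul max_ideal (ideal_exp I l) >].
Arguments fiber_ideal : clear implicits.

Lemma max_ideal_eval0 f : f \in max_ideal -> f.@[fun=> 0] = 0.
Proof.
move=> /ideal_genP[k [c [s [sX ->]]]]; rewrite raddf_sum big1 //= => i _.
have /existsP[j /eqP->] := sX i.
by rewrite mevalM mevalXU mulr0.
Qed.

Lemma one_notin_max_ideal : 1 \notin max_ideal.
Proof.
by apply/negP => /max_ideal_eval0/eqP; rewrite meval1 oner_eq0.
Qed.

Lemma fiber_ideal_closed I : idealr_closed (fiber_ideal I).
Proof.
split.
- apply/asboolP => l; rewrite coef0.
  by case: (ideal_mul_is_ideal max_ideal (ideal_exp I l)).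
- apply/negP => /asboolP/(_ 0%N); rewrite coef1 /= => m1.
  case/negP: one_notin_max_ideal; move: m1.
  apply: ideal_mul_sub; first exact: ideal_gen_is_ideal.
  move=> u v um _; rewrite mulrC.
  by case: (ideal_gen_is_ideal [pred f : R | [exists i, f == 'X_i]]) => _ _; apply.
- move=> a u v /asboolP um /asboolP vm; apply/asboolP => l.
  have idl := ideal_mul_is_ideal max_ideal (ideal_exp I l).
  rewrite coefD; case: (idl) => _ addl _; apply: addl => //.
  rewrite mulrC coefM; apply: ideal_sum idl _ => i.
  have /in_reesP/(_ (l - i)%N) := valP a.
  move: (um i) => /ideal_mul_expM /[apply].
  by rewrite subnKC // leq_ord.
Qed.

HB.instance Definition _ I :=
  isIdealr.Build (rees I) (fiber_ideal I) (fiber_ideal_closed I).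

Definition fiber_ring I := {ideal_quot (fiber_ideal I)}.

HB.instance Definition _ I := GRing.ComNzRing.on (fiber_ring I).

Lemma rees_const_subproof I (c : K) : in_rees I (c%:MP%:P : {poly R}).
Proof.
apply/in_reesP => l; rewrite coefC; case: l => //= l.
by case: (ideal_exp_is_ideal I l.+1).
Qed.

Definition rees_const I (c : K) : rees I :=
  exist _ (c%:MP%:P) (rees_const_subproof I c).

Definition fiber_scale I (c : K) (x : fiber_ring I) : fiber_ring I :=
  \pi_(fiber_ring I) (rees_const I c) * x.

Lemma fiber_scaleA I a b (x : fiber_ring I) :
  fiber_scale a (fiber_scale b x) = fiber_scale (a * b) x.
Proof.
rewrite /fiber_scale mulrA -rmorphM; congr (\pi _ * x).
by apply: val_inj; rewrite /= -polyCM -mpolyCM.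
Qed.

Lemma fiber_scale1 I : left_id 1 (@fiber_scale I).
Proof.
move=> x; rewrite /fiber_scale (_ : rees_const I 1 = 1) ?rmorph1 ?mul1r //.
exact: val_inj.
Qed.

Lemma fiber_scaleDr I : right_distributive (@fiber_scale I) +%R.
Proof. by move=> c x y; rewrite /fiber_scale mulrDr. Qed.

Lemma fiber_scaleDl I (x : fiber_ring I) :
  {morph (@fiber_scale I)^~ x : a b / a + b}.
Proof.
move=> a b; rewrite /fiber_scale -mulrDl -rmorphD; congr (\pi _ * x).
by apply: val_inj; rewrite /= -polyCD -mpolyCD.
Qed.

HB.instance Definition _ I := GRing.Zmodule_isLmodule.Build K (fiber_ring I)
  (@fiber_scaleA I) (@fiber_scale1 I) (@fiber_scaleDr I) (@fiber_scaleDl I).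

Lemma fiber_scaleAl I (c : K) (x y : fiber_ring I) : c *: (x * y) = c *: x * y.
Proof. exact: mulrA. Qed.

HB.instance Definition _ I :=
  GRing.Lmodule_isLalgebra.Build K (fiber_ring I) (@fiber_scaleAl I).
HB.instance Definition _ I :=
  GRing.Lalgebra_isComAlgebra.Build K (fiber_ring I).

(* The image of I^l t^l, i.e. I^l / m I^l. *)
Definition fiber_piece I (l : nat) : {pred fiber_ring I} := fun x =>
  `[< exists (f : R) (s : rees I),
        [/\ f \in ideal_exp I l, val s = f *: 'X^l
          & x = \pi_(fiber_ring I) s] >].

End SpecialFiber.

Section FerrersBox.
Variables (K : fieldType) (a b c : nat).

Definition x_ (i : 'I_a) : {mpoly K[a + b + c]} := 'X_(lshift c (lshift b i)).
Definition y_ (j : 'I_b) : {mpoly K[a + b + c]} := 'X_(lshift c (rshift a j)).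
Definition z_ (k : 'I_c) : {mpoly K[a + b + c]} := 'X_(rshift (a + b) k).

Definition box_ideal : {pred {mpoly K[a + b + c]}} :=
  ideal_gen [pred f | [exists i, exists j, exists k, f == x_ i * y_ j * z_ k]].

End FerrersBox.

Arguments fiber_ideal {K n} I _.
Arguments fiber_piece {K n} I l _.
Arguments box_ideal K a b c _ : clear implicits.

(* Main.v *)
Require Import Defs.
From HB Require Import structures.
From mathcomp Require Import all_boot all_order all_algebra.
From mathcomp Require Import mpoly boolp.
From mathcomp Require Import zify.
Import GRing.Theory.
Local Open Scope ring_scope.
Local Open Scope quotient_scope.

(* Every monomial of I^l has degree at least 3l, and m I^l consists of the    *)
(* elements of I^l without component of degree 3l. Hence taking components of *)
(* degree 3l embeds the fiber ring into R[t], with degree l part spanned by   *)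
(* the monomials of tridegree (l, l, l), in number                            *)
(* C(l+a-1, l) C(l+b-1, l) C(l+c-1, l).                                       *)
(* The Krull dimension is at most a+b+c-2 because elements separating the     *)
(* members of a chain of n+1 primes are algebraically independent modulo the  *)
(* smallest one, so that n cannot exceed the growth exponent of the algebra.  *)
(* Setting the variables x_i, y_j, z_k to zero one after the other, while     *)
(* keeping one of each kind until the end, gives a chain of that length.      *)

(** Both inputs of the multiplicity come from one embedding. Taking components of degree 3l in I^l
    is multiplicative because these are the lowest possible components ([pihomogM]), and its kernel
    is exactly m I^l ([pihomog_eq0_ideal_mul]). So [toric] is an injective ring morphism into R[t],
    and its image is the Segre product of three polynomial rings.

    The Hilbert function is therefore a product of three binomials ([has_dim_fiber_piece],
    [size_tri_mons]). Each is a polynomial in l, of degrees a-1, b-1, c-1, with leading coefficient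
    the inverse factorial of its degree. The product has degree a+b+c-3, and multiplying its leading
    coefficient by (a+b+c-3)! gives the multinomial coefficient.

    The Krull dimension is computed from chains of primes. [prime_chain_le] bounds them by playing
    [prime_chain_independent] against [linear_relation]; [kill_prime_chain] exhibits a chain
    reaching the bound. *)

Section IdealClosure.
Variables (A : comNzRingType) (P : {pred A}).
Hypothesis idP : idealr_closed P.

Lemma idealr_closed_mull u v : v \in P -> u * v \in P.
Proof. by case: idP => P0 _ PD vP; rewrite -[_ * _]addr0 PD. Qed.

Lemma idealr_closed_addl_cancel u v : u + v \in P -> v \in P -> u \in P.
Proof.
case: idP => _ _ PD uvP vP.
by rewrite -[u](addrK v) addrC -mulN1r PD.
Qed.

End IdealClosure.

(** * Chains of primes and algebraic independence *)

Section PrimeChains.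
Variables (K : fieldType) (A : comAlgType K).

Fixpoint expo (N n : nat) : finType :=
  if n is n'.+1 then ('I_N * expo N n')%type else unit.

Fixpoint expo_prod (N n : nat) (x : nat -> A) : expo N n -> A :=
  if n is n'.+1 then
    fun e : expo N n'.+1 => x 0%N ^+ e.1 * expo_prod N n' (fun i => x i.+1) e.2
  else fun=> 1.

Lemma card_expo N n : #|expo N n| = (N ^ n)%N.
Proof.
elim: n => [|n IHn]; first by rewrite card_unit.
by rewrite /= card_prod card_ord IHn expnS.
Qed.

(** Since [x] is in [Q], the sum is congruent to [F 0] modulo [Q], so [F 0] vanishes. Then [x]
    factors out of the sum and, not being in the prime [P], can be cancelled; induction on [N]
    treats the remaining terms. *)
Lemma prime_step (P Q : {pred A}) (x : A) :
    idealr_closed P -> prime_idealr_closed P -> idealr_closed Q ->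
    {subset P <= Q} -> x \notin P -> x \in Q ->
  forall N (F : nat -> A), (forall j, (j < N)%N -> F j \in Q -> F j = 0) ->
    \sum_(j < N) x ^+ j * F j \in P -> forall j, (j < N)%N -> F j = 0.
Proof.
move=> idP prP idQ sPQ xNP xQ; elim=> [|N IHN] F FQ sumP // j ltjN.
have sumE : \sum_(j < N.+1) x ^+ j * F j =
    F 0%N + x * \sum_(j < N) x ^+ j * F j.+1.
  rewrite big_ord_recl expr0 mul1r mulr_sumr; congr (_ + _).
  by apply: eq_bigr => i _; rewrite mulrA -exprS.
have F0 : F 0%N = 0.
  apply: FQ => //; move: sumP => /sPQ; rewrite sumE.
  move=> /(idealr_closed_addl_cancel _ _ idQ); apply.
  by rewrite mulrC idealr_closed_mull.
case: j ltjN => // j ltjN; apply: (IHN (F \o succn)) => //= [i ltiN|].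
  exact: FQ.
move: sumP; rewrite sumE F0 add0r => /prP.
by rewrite (negPf xNP).
Qed.

(* Coquand-Lombardi: split off the lowest power of x_0; the cofactor then     *)
(* lies in P_1, which no longer sees x_0.                                     *)
Lemma prime_chain_independent N n (P : nat -> {pred A}) (x : nat -> A) :
    prime_chain n P ->
    (forall i, (i < n)%N -> x i \notin P i /\ x i \in P i.+1) ->
  forall c : expo N n -> K,
    \sum_e c e *: expo_prod N n x e \in P 0%N -> forall e, c e = 0.
Proof.
elim: n P x => [|n IHn] P x [prP inP] xP c.
  have [[_ P1 _] _] := prP 0%N isT => /= sumP e; apply: contraNeq P1 => ce.
  have {sumP} sumP : c e *: 1 \in P 0%N.
    by move: sumP; rewrite (big_pred1 e) //; case: e {ce} => -[].
  rewrite -[1](scalerK ce) -[_ *: (_ *: _)]mulr_algl.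
  exact: (idealr_closed_mull _ _ (prP 0%N isT).1).
have chP : prime_chain n (fun i => P i.+1).
  by split=> [i le_in|i lt_in]; [apply: prP | apply: inP].
have [xN0 x1] := xP 0%N isT.
pose F (j : nat) : A := if insub j is Some j' then
   \sum_(e : expo N n) c (j', e) *: expo_prod N n (fun i => x i.+1) e else 0.
have FE (j : 'I_N) : F j =
    \sum_(e : expo N n) c (j, e) *: expo_prod N n (fun i => x i.+1) e.
  by rewrite /F valK.
have IHF (j : 'I_N) : F j \in P 1%N -> forall e, c (j, e) = 0.
  rewrite FE; apply: (IHn (fun i => P i.+1)) => // i; exact: (xP i.+1).
move=> sumP.
have F0 : forall j, (j < N)%N -> F j = 0.
  apply: (@prime_step (P 0%N) (P 1%N) (x 0%N)) => //.
  - exact: (prP 0%N isT).1.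
  - exact: (prP 0%N isT).2.
  - exact: (prP 1%N isT).1.
  - exact: (inP 0%N isT).1.
  - move=> j ltjN /(IHF (Ordinal ltjN)) c0.
    by rewrite (FE (Ordinal ltjN)) big1 // => e _; rewrite c0 scale0r.
  rewrite (_ : \sum_(j < N) _ =
    \sum_(e : expo N n.+1) c e *: expo_prod N n.+1 x e) //.
  under eq_bigr => j _ do rewrite FE mulr_sumr.
  rewrite pair_bigA; apply: eq_bigr => -[j e] _ /=.
  by rewrite scalerAr.
(* Each [F j] is zero, hence in [P 1], and the induction hypothesis applies to its coefficients. *)
case=> j e; apply: IHF; rewrite F0 //.
by case: (prP 1%N isT) => -[].
Qed.

End PrimeChains.

(** The values of the functionals on the family form a matrix with more rows than columns; a nonzero
    vector of its left kernel gives the coefficients. No ambient finite-dimensional space is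
    required, only functionals that detect zero on the combinations. *)
Lemma linear_relation (K : fieldType) (V : lmodType K) (T : finType)
    (v : T -> V) m (f : 'I_m -> {scalar V}) :
    (m < #|T|)%N ->
    (forall c : T -> K, (forall j, f j (\sum_t c t *: v t) = 0) ->
       \sum_t c t *: v t = 0) ->
  exists2 c : T -> K, exists t, c t != 0 & \sum_t c t *: v t = 0.
Proof.
move=> ltmT f_inj.
pose M := \matrix_(i < #|T|, j < m) f j (v (enum_val i)).
have : kermx M != 0.
  rewrite kermx_eq0; apply: contraL ltmT => /eqP <-.
  by rewrite -leqNgt rank_leq_col.
case/rowV0Pn=> u /sub_kermxP uM0 u0.
have [i ui] : exists i, u 0 i != 0 by apply/rV0Pn.
exists (fun t => u 0 (enum_rank t)); first by exists (enum_val i); rewrite enum_valK.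
apply: f_inj => j; have := congr1 (fun B : 'rV_m => B 0 j) uM0.
rewrite !mxE => <-; rewrite linear_sum /= (reindex_onto enum_val enum_rank) /=;
  last by move=> t _; rewrite enum_rankK.
rewrite (eq_bigl predT) => [|k]; last by rewrite enum_valK eqxx.
by apply: eq_bigr => k _; rewrite enum_valK linearZ /= mxE.
Qed.

Lemma mdeg_gt0 n (u : 'X_{1..n}) : (0 < mdeg u)%N -> exists i, (0 < u i)%N.
Proof.
rewrite lt0n mdeg_eq0 => uN0; apply/existsP; apply: contraR uN0.
rewrite negb_exists => /forallP u0; apply/eqP/mnmP => i.
by rewrite mnm0E; apply/eqP; rewrite -leqn0 leqNgt u0.
Qed.

(** * Order of a polynomial and lowest homogeneous components *)

Section LowestForms.
Variables (K : fieldType) (n : nat).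
Implicit Types (f g : {mpoly K[n]}) (m : 'X_{1..n}).

Lemma mcoeff_pihomog d f m :
  (pihomog mdeg d f)@_m = if mdeg m == d then f@_m else 0.
Proof.
rewrite pihomogE raddf_sum /= big_mkcond /=.
have [m_f|mNf] := boolP (m \in msupp f).
  rewrite (bigD1_seq m) ?msupp_uniq //= big1 ?addr0 => [|m' m'Nm].
    by case: eqP => // _; rewrite mcoeffZ mcoeffX eqxx mulr1.
  by case: ifP => // _; rewrite mcoeffZ mcoeffX (negPf m'Nm) mulr0.
rewrite big1_seq; first by rewrite memN_msupp_eq0 // if_same.
move=> m' /andP[_ m'f]; case: ifP => // _; rewrite mcoeffZ mcoeffX.
by case: eqP m'f => [->|_ _]; rewrite ?mulr0 // (negPf mNf).
Qed.

Definition order_ge k : {pred {mpoly K[n]}} :=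
  [pred f | all (fun m => k <= mdeg m)%N (msupp f)].

Lemma order_geP k f :
  reflect (forall m, (mdeg m < k)%N -> f@_m = 0) (f \in order_ge k).
Proof.
apply: (iffP allP) => [f_k m|f_k m]; last first.
  by rewrite mcoeff_msupp leqNgt; apply: contra => /f_k->.
by rewrite ltnNge; apply: contraNeq; rewrite -mcoeff_msupp; apply: f_k.
Qed.

Lemma order_geM i j f g :
  f \in order_ge i -> g \in order_ge j -> f * g \in order_ge (i + j).
Proof.
move=> /allP fi /allP gj; apply/allP => m /msuppM_le /allpairsP[[m1 m2] /=].
by case=> /fi le1 /gj le2 ->; rewrite mdegD leq_add.
Qed.

Lemma order_ge_is_ideal k : is_ideal (order_ge k).
Proof.
split; first by apply/order_geP => m _; rewrite mcoeff0.
  move=> f g /order_geP fk /order_geP gk; apply/order_geP => m ltmk.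
  by rewrite mcoeffD fk ?gk ?addr0.
move=> c f fk; rewrite -[k]add0n; apply: order_geM => //.
by apply/order_geP.
Qed.

Lemma ideal_mul_order_ge (I J : {pred {mpoly K[n]}}) i j :
    {subset I <= order_ge i} -> {subset J <= order_ge j} ->
  {subset ideal_mul I J <= order_ge (i + j)}.
Proof.
move=> Ii Jj; apply: ideal_mul_sub; first exact: order_ge_is_ideal.
by move=> u v /Ii ui /Jj vj; apply: order_geM.
Qed.

Lemma ideal_exp_order_ge (I : {pred {mpoly K[n]}}) i l :
  {subset I <= order_ge i} -> {subset ideal_exp I l <= order_ge (l * i)}.
Proof.
move=> Ii; elim: l => [|l IHl] f; first by move=> _; apply/order_geP.
by rewrite mulSn; apply: ideal_mul_order_ge.
Qed.

Lemma max_ideal_order_ge : {subset @max_ideal K n <= order_ge 1}.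
Proof.
apply: ideal_gen_sub; first exact: order_ge_is_ideal.
move=> _ /existsP[i /eqP->]; apply/order_geP => m.
rewrite ltnS leqn0 mdeg_eq0 => /eqP->.
by rewrite mcoeffX mnm1_eq0.
Qed.

Lemma pihomog_order_ge k f : f \in order_ge k.+1 -> pihomog mdeg k f = 0.
Proof.
move=> /order_geP fk; apply/mpolyP => m; rewrite mcoeff_pihomog mcoeff0.
by case: eqP => // mk; rewrite fk ?mk.
Qed.

Lemma pihomogM i j f g : f \in order_ge i -> g \in order_ge j ->
  pihomog mdeg (i + j) (f * g) = pihomog mdeg i f * pihomog mdeg j g.
Proof.
have lower k h : h \in order_ge k -> h - pihomog mdeg k h \in order_ge k.+1.
  move=> /order_geP hk; apply/order_geP => m; rewrite ltnS mcoeffB mcoeff_pihomog.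
  by case: ltngtP => // [/hk->|_ _]; rewrite subrr.
have pi_ge k h : pihomog mdeg k h \in order_ge k.
  by apply/order_geP => m ltmk; rewrite mcoeff_pihomog ltn_eqF.
(* Replacing first [f] and then [g] by its lowest component changes the product only in degrees
   above [i + j]. *)
move=> fi gj; rewrite -[in LHS](subrK (pihomog mdeg i f) f) mulrDl pihomogD.
rewrite pihomog_order_ge ?add0r; last by rewrite -addSn order_geM ?lower.
rewrite -[in LHS](subrK (pihomog mdeg j g) g) mulrDr pihomogD.
rewrite pihomog_order_ge ?add0r; last by rewrite -addnS order_geM ?lower.
by apply: pihomog_dE; apply: dhomogM; apply: pihomogP.
Qed.

(** Every nonconstant monomial is divisible by a variable. *)
Lemma mpoly_sub_const_max_ideal f : f - (f@_0%MM)%:MP \in @max_ideal K n.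
Proof.
have [I0 ID IM] : is_ideal (@max_ideal K n) by apply: ideal_gen_is_ideal.
rewrite [X in X - _]mpolyE.
have -> : (f@_0%MM)%:MP = \sum_(m <- msupp f) (if m == 0%MM then f@_m else 0)%:MP
    :> {mpoly K[n]}.
  have [f0|fN0] := boolP (0%MM \in msupp f).
    rewrite (bigD1_seq 0%MM) ?msupp_uniq //= big1 ?eqxx ?addr0 //.
    by move=> m /negPf->; rewrite mpolyC0.
  rewrite memN_msupp_eq0 // mpolyC0 big1_seq // => m /andP[_ mf].
  by case: eqP mf => [->|]; rewrite ?(negPf fN0) ?mpolyC0.
rewrite -sumrB; elim/big_ind: _ => // m _.
case: eqP => [->|/eqP mN0].
  by rewrite mpolyX0 -mul_mpolyC mulr1 subrr.
rewrite mpolyC0 subr0 -mul_mpolyC; apply: (IM).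
have [|i mi] := @mdeg_gt0 _ m; first by rewrite lt0n mdeg_eq0.
have /submK <- : (U_(i) <= m)%MM.
  by apply/mnm_lepP => j; rewrite mnm1E; case: eqP => // <-.
rewrite mpolyXD; apply: IM; apply: mem_ideal_gen.
by apply/existsP; exists i.
Qed.

End LowestForms.

(** * Tridegrees and leading forms of the powers of the box ideal *)

Section Trigraded.
Variables (a b c : nat).
Local Notation mon := 'X_{1..a + b + c}.
Implicit Type m : mon.

Definition xpart m : 'X_{1..a} := [multinom m (lshift c (lshift b i)) | i < a].
Definition ypart m : 'X_{1..b} := [multinom m (lshift c (rshift a j)) | j < b].
Definition zpart m : 'X_{1..c} := [multinom m (rshift (a + b) k) | k < c].

Definition join_mon (u : 'X_{1..a}) (v : 'X_{1..b}) (w : 'X_{1..c}) : mon :=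
  [multinom match split i with
            | inl ij => match split ij with inl i' => u i' | inr j => v j end
            | inr k => w k
            end | i < a + b + c].

Lemma split_lshift p q (i : 'I_p) : split (lshift q i) = inl i.
Proof. exact: (unsplitK (inl i)). Qed.

Lemma split_rshift p q (i : 'I_q) : split (rshift p i) = inr i.
Proof. exact: (unsplitK (inr i)). Qed.

Lemma xpart_join u v w : xpart (join_mon u v w) = u.
Proof. by apply/mnmP => i; rewrite !mnmE !split_lshift. Qed.

Lemma ypart_join u v w : ypart (join_mon u v w) = v.
Proof. by apply/mnmP => i; rewrite !mnmE split_lshift split_rshift. Qed.

Lemma zpart_join u v w : zpart (join_mon u v w) = w.
Proof. by apply/mnmP => i; rewrite !mnmE split_rshift. Qed.

Lemma join_parts m : join_mon (xpart m) (ypart m) (zpart m) = m.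
Proof.
apply/mnmP => i; rewrite mnmE; case: (splitP i) => [j ij|k ik].
  case: (splitP j) => [i' ji'|j' jj']; rewrite mnmE; congr (m _); apply/val_inj.
    by rewrite /= ij ji'.
  by rewrite /= ij jj'.
by rewrite mnmE; congr (m _); apply/val_inj; rewrite /= ik.
Qed.

Lemma mdeg_parts m :
  mdeg m = (mdeg (xpart m) + mdeg (ypart m) + mdeg (zpart m))%N.
Proof.
rewrite !mdegE !big_split_ord /=.
by congr (_ + _ + _)%N; apply: eq_bigr => i _; rewrite mnmE.
Qed.

Lemma xpartD m1 m2 : xpart (m1 + m2) = (xpart m1 + xpart m2)%MM.
Proof. by apply/mnmP => i; rewrite !mnmE. Qed.

Lemma ypartD m1 m2 : ypart (m1 + m2) = (ypart m1 + ypart m2)%MM.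
Proof. by apply/mnmP => i; rewrite !mnmE. Qed.

Lemma zpartD m1 m2 : zpart (m1 + m2) = (zpart m1 + zpart m2)%MM.
Proof. by apply/mnmP => i; rewrite !mnmE. Qed.

Definition tridegree l m :=
  [&& mdeg (xpart m) == l, mdeg (ypart m) == l & mdeg (zpart m) == l].

Lemma tridegree_mdeg l m : tridegree l m -> mdeg m = (l * 3)%N.
Proof. by rewrite mdeg_parts => /and3P[/eqP-> /eqP-> /eqP->]; lia. Qed.

Lemma tridegreeD k l m1 m2 :
  tridegree k m1 -> tridegree l m2 -> tridegree (k + l) (m1 + m2).
Proof.
move=> /and3P[/eqP x1 /eqP y1 /eqP z1] /and3P[/eqP x2 /eqP y2 /eqP z2].
by rewrite /tridegree xpartD ypartD zpartD !mdegD x1 y1 z1 x2 y2 z2 !eqxx.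
Qed.

Definition box_mon (i : 'I_a) (j : 'I_b) (k : 'I_c) : mon :=
  (U_(lshift c (lshift b i)) + U_(lshift c (rshift a j))
    + U_(rshift (a + b) k))%MM.

Lemma box_monE i j k : box_mon i j k = join_mon U_(i) U_(j) U_(k).
Proof.
apply/mnmP => t; rewrite !mnmE; case: (splitP t) => [s ts|k' tk].
  case: (splitP s) => [i' si'|j' sj']; rewrite !mnmE -!val_eqE /= ts.
    rewrite si'; have := ltn_ord i'; case: eqP; case: eqP; case: eqP; lia.
  rewrite sj'; have := ltn_ord j'; have := ltn_ord i.
  case: eqP; case: eqP; case: eqP; case: eqP; lia.
rewrite !mnmE -!val_eqE /= tk; have := ltn_ord j; have := ltn_ord i.
case: eqP; case: eqP; case: eqP; case: eqP; lia.
Qed.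

Lemma tridegree_box i j k : tridegree 1 (box_mon i j k).
Proof.
by rewrite box_monE /tridegree xpart_join ypart_join zpart_join !mdeg1 eqxx.
Qed.

(** One variable of each kind divides [m], and in a full box any such triple is a generator. Hence
    all monomials of tridegree (l, l, l) lie in I^l. *)
Lemma tridegreeS l m : tridegree l.+1 m ->
  exists i j k m', tridegree l m' /\ m = (box_mon i j k + m')%MM.
Proof.
move=> /and3P[/eqP xm /eqP ym /eqP zm].
have pos n (u : 'X_{1..n}) : mdeg u = l.+1 ->
    exists i u', mdeg u' = l /\ u = (U_(i) + u')%MM.
  move=> ul; have [|i ui] := @mdeg_gt0 _ u; first by rewrite ul.
  have /submK uE : (U_(i) <= u)%MM.
    by apply/mnm_lepP => t; rewrite mnm1E; case: eqP => // <-.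
  exists i, (u - U_(i))%MM; split; last by rewrite addmC uE.
  by have := congr1 mdeg uE; rewrite mdegD mdeg1 ul; lia.
have [i [u [ul xE]]] := pos _ _ xm.
have [j [v [vl yE]]] := pos _ _ ym.
have [k [w [wl zE]]] := pos _ _ zm.
exists i, j, k, (join_mon u v w); split.
  by rewrite /tridegree xpart_join ypart_join zpart_join ul vl wl eqxx.
rewrite -[m]join_parts xE yE zE box_monE.
apply/mnmP => t; rewrite !mnmE.
by case: (split t) => [s|k']; [case: (split s) => [i'|j']|]; rewrite !mnmE.
Qed.

(** [basis] encodes monomials as sorted tuples of variable indices, a form whose cardinality is
    given by [size_basis]. *)
Definition mons n d : seq 'X_{1..n} :=
  [seq @s2m n t | t : d.-tuple 'I_n <- enum (basis n d)].

Definition tri_mons l : seq mon :=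
  [seq join_mon uv.1 uv.2 w
    | uv <- [seq (u, v) | u <- mons a l, v <- mons b l], w <- mons c l].

Lemma mem_mons n d (u : 'X_{1..n}) : (u \in mons n d) = (mdeg u == d).
Proof. by rewrite -basis_cover. Qed.

Lemma mem_tri_mons l m : (m \in tri_mons l) = tridegree l m.
Proof.
apply/allpairsP/idP => [[[uv w]] /= [/allpairsP[[u v] /= [ul vl ->]] wl ->]|].
  rewrite /tridegree xpart_join ypart_join zpart_join.
  by rewrite -!mem_mons ul vl wl.
move=> /and3P[xm ym zm]; exists ((xpart m, ypart m), zpart m) => /=.
by rewrite mem_mons join_parts; split=> //; apply: allpairs_f; rewrite mem_mons.
Qed.

Lemma uniq_tri_mons l : uniq (tri_mons l).
Proof.
apply: allpairs_uniq; [apply: allpairs_uniq|exact: uniq_basis|];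
  rewrite ?uniq_basis //.
  by move=> [u v] [u' v'] _ _ [-> ->].
move=> [[u v] w] [[u' v'] w'] _ _ /= eqm.
have := (congr1 xpart eqm, congr1 ypart eqm, congr1 zpart eqm).
by rewrite !xpart_join !ypart_join !zpart_join => -[[-> ->] ->].
Qed.

Variable K : fieldType.
Implicit Types f g : {mpoly K[a + b + c]}.

Definition triform l : {pred {mpoly K[a + b + c]}} :=
  [pred f | all (tridegree l) (msupp f)].

Lemma triformP l f :
  reflect (forall m, ~~ tridegree l m -> f@_m = 0) (f \in triform l).
Proof.
apply: (iffP allP) => [f_l m|f_l m]; last first.
  by rewrite mcoeff_msupp; apply: contraR => /f_l->.
by apply: contraNeq; rewrite -mcoeff_msupp; apply: f_l.
Qed.

Lemma triform0 l : 0 \in triform l.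
Proof. by apply/triformP => m _; rewrite mcoeff0. Qed.

Lemma triformD l f g : f \in triform l -> g \in triform l -> f + g \in triform l.
Proof.
move=> /triformP fl /triformP gl; apply/triformP => m ml.
by rewrite mcoeffD fl ?gl ?addr0.
Qed.

Lemma triformZ l x f : f \in triform l -> x *: f \in triform l.
Proof. by move=> /triformP fl; apply/triformP => m ml; rewrite mcoeffZ fl ?mulr0. Qed.

Lemma triformX l m : tridegree l m -> 'X_[m] \in triform l.
Proof. by rewrite inE msuppX /= andbT. Qed.

Lemma triformM k l f g :
  f \in triform k -> g \in triform l -> f * g \in triform (k + l).
Proof.
move=> /allP fk /allP gl; apply/allP => m /msuppM_le /allpairsP[[m1 m2] /=].
by case=> /fk h1 /gl h2 ->; apply: tridegreeD.
Qed.

Lemma triform_homog l f : f \in triform l -> pihomog mdeg (l * 3) f = f.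
Proof.
by move=> /allP fl; apply/pihomog_dE/dhomogP => m /fl/tridegree_mdeg.
Qed.

Local Notation I := (box_ideal K a b c).

Lemma mpolyX_box i j k : 'X_[box_mon i j k] = x_ K b c i * y_ K a c j * z_ K a b k.
Proof. by rewrite !mpolyXD. Qed.

Lemma tridegree_ideal_exp l m : tridegree l m -> 'X_[m] \in ideal_exp I l.
Proof.
elim: l m => [|l IHl] m //= /tridegreeS[i [j [k [m' [m'l ->]]]]].
rewrite mpolyXD; apply: mem_ideal_mul; last exact: IHl.
apply: mem_ideal_gen; apply/existsP; exists i; apply/existsP; exists j.
by apply/existsP; exists k; rewrite mpolyX_box.
Qed.

Lemma triform_ideal_exp l : {subset triform l <= ideal_exp I l}.
Proof.
have [I0 ID IM] := ideal_exp_is_ideal I l.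
move=> f /allP fl; rewrite [f]mpolyE big_seq; elim/big_ind: _ => // m /fl ml.
by rewrite -mul_mpolyC IM ?tridegree_ideal_exp.
Qed.

Lemma box_ideal_order : {subset I <= order_ge K _ 3}.
Proof.
apply: ideal_gen_sub; first exact: order_ge_is_ideal.
move=> _ /existsP[i /existsP[j /existsP[k /eqP->]]]; rewrite -mpolyX_box.
by rewrite inE msuppX /= (@tridegree_mdeg 1) ?tridegree_box.
Qed.

Lemma ideal_exp_order l : {subset ideal_exp I l <= order_ge K _ (l * 3)}.
Proof. exact/ideal_exp_order_ge/box_ideal_order. Qed.

Definition has_leading_form l f :=
  exists2 g, g \in triform l & f - g \in ideal_mul (@max_ideal K _) (ideal_exp I l).

Lemma has_leading_form_is_ideal l : is_ideal [pred f | `[< has_leading_form l f >]].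
Proof.
have [J0 JD JM] := ideal_mul_is_ideal (@max_ideal K _) (ideal_exp I l).
split.
- by apply/asboolP; exists 0; rewrite ?triform0 ?subrr.
- move=> f1 f2 /asboolP[g1 g1l fg1] /asboolP[g2 g2l fg2]; apply/asboolP.
  by exists (g1 + g2); rewrite ?triformD // opprD addrACA JD.
- move=> h f /asboolP[g gl fg]; apply/asboolP.
  (* Modulo m only the constant term of [h] acts: h f - h(0) g = h (f - g) + (h - h(0)) g. *)
  exists (h@_0%MM *: g); first exact: triformZ.
  rewrite -mul_mpolyC -[h * f](subrK (h * g)) -mulrBr -addrA -mulrBl.
  apply: JD; first exact: JM.
  by apply: mem_ideal_mul; [apply: mpoly_sub_const_max_ideal|apply: triform_ideal_exp].
Qed.

Lemma ideal_exp_leading_form l f : f \in ideal_exp I l -> has_leading_form l f.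
Proof.
elim: l f => [|l IHl] f.
  move=> _; exists (f@_0%MM)%:MP.
    rewrite -[_%:MP]mulr1 mul_mpolyC triformZ // -mpolyX0 triformX //.
    by apply/and3P; split; rewrite mdeg_eq0; apply/eqP/mnmP => i; rewrite !mnmE.
  rewrite -[_ - _]mulr1; apply: mem_ideal_mul => //.
  exact: mpoly_sub_const_max_ideal.
move=> fI; apply/asboolP; move: f fI.
have idL := has_leading_form_is_ideal l.+1.
apply: (@ideal_mul_sub _ _ _ [pred f | `[< has_leading_form l.+1 f >]]) => // u v uI vI.
(* For fixed [v] the admissible [u] form an ideal, so only the generators of I need to be tried. *)
suff : {subset I <=
    [pred u | u * v \in [pred f | `[< has_leading_form l.+1 f >]]]} by apply.
apply: ideal_gen_sub; first exact: ideal_transporter.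
move=> _ /existsP[i /existsP[j /existsP[k /eqP->]]]; rewrite -mpolyX_box !inE.
have [g gl vg] := IHl v vI; apply/asboolP; exists ('X_[box_mon i j k] * g).
  by apply: (@triformM 1) => //; apply/triformX/tridegree_box.
rewrite -mulrBr mulrC.
have := @ideal_mul_expM _ (@max_ideal K _) I l 1 _ 'X_[box_mon i j k] vg.
by rewrite addn1; apply; rewrite tridegree_ideal_exp ?tridegree_box.
Qed.

Lemma leading_form_ideal_exp l f : f \in ideal_exp I l ->
  pihomog mdeg (l * 3) f \in triform l /\
  f - pihomog mdeg (l * 3) f \in ideal_mul (@max_ideal K _) (ideal_exp I l).
Proof.
move=> /ideal_exp_leading_form[g gl fg].
suff -> : pihomog mdeg (l * 3) f = g by [].
rewrite -[f](subrK g) pihomogD (triform_homog l g gl) pihomog_order_ge ?add0r //.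
rewrite -add1n; move: fg; apply: ideal_mul_order_ge.
  exact: max_ideal_order_ge.
exact: ideal_exp_order.
Qed.

(** Elements of m I^l have order at least 3l+1; conversely an element of I^l differs from its
    component of degree 3l by an element of m I^l. *)
Lemma pihomog_eq0_ideal_mul l f : f \in ideal_exp I l ->
  (f \in ideal_mul (@max_ideal K _) (ideal_exp I l)) =
  (pihomog mdeg (l * 3) f == 0).
Proof.
move=> fI; apply/idP/eqP => [fm|f0]; last first.
  by have [_] := leading_form_ideal_exp _ _ fI; rewrite f0 subr0.
apply: pihomog_order_ge; rewrite -add1n; move: f fm {fI}.
apply: ideal_mul_order_ge; [exact: max_ideal_order_ge|exact: ideal_exp_order].
Qed.

End Trigraded.

Lemma size_tri_mons a b c l : size (tri_mons a.+1 b.+1 c.+1 l) =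
  ('C(l + a, l) * 'C(l + b, l) * 'C(l + c, l))%N.
Proof. by rewrite !size_allpairs !size_basis. Qed.

(** * Embedding of the fiber ring into R[t] *)

Section ToricEmbedding.
Variables (K : fieldType) (a b c : nat).
Local Notation R := {mpoly K[a + b + c]}.
Local Notation I := (box_ideal K a b c).
Local Notation F := (fiber_ring I).

Definition leading_poly (p : rees I) : {poly R} :=
  \poly_(l < size (val p)) pihomog mdeg (l * 3) (val p)`_l.

Lemma coef_leading_poly p l :
  (leading_poly p)`_l = pihomog mdeg (l * 3) (val p)`_l.
Proof. by rewrite coef_poly; case: ltnP => // le; rewrite nth_default ?pihomog0. Qed.

Lemma rees_coef (p : rees I) l : (val p)`_l \in ideal_exp I l.
Proof. by have /in_reesP := valP p. Qed.

Lemma leading_polyB : {morph leading_poly : p q / p - q}.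
Proof.
by move=> p q; apply/polyP => l; rewrite coefB !coef_leading_poly coefB pihomogB.
Qed.

Lemma leading_polyM : {morph leading_poly : p q / p * q}.
Proof.
move=> p q; apply/polyP => l; rewrite coef_leading_poly /= !coefM raddf_sum /=.
apply: eq_bigr => i _; rewrite !coef_leading_poly -pihomogM.
- by rewrite -mulnDl subnKC // -ltnS.
- exact/ideal_exp_order/rees_coef.
- exact/ideal_exp_order/rees_coef.
Qed.

Lemma leading_poly_const x : leading_poly (rees_const I x) = (x%:MP)%:P.
Proof.
apply/polyP => l; rewrite coef_leading_poly !coefC.
case: eqP => [->|_]; last by rewrite pihomog0.
by rewrite -[_%:MP]mulr1 mul_mpolyC linearZ /= -mpolyX0 pihomogX /= mdeg0.
Qed.

Lemma leading_poly1 : leading_poly 1 = 1.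
Proof.
have -> : (1 : rees I) = rees_const I 1 by exact: val_inj.
by rewrite leading_poly_const mpolyC1.
Qed.

Lemma leading_poly_eq0 p : (leading_poly p == 0) = (p \in fiber_ideal I).
Proof.
apply/eqP/asboolP => [p0 l|p0].
  rewrite pihomog_eq0_ideal_mul ?rees_coef //.
  by rewrite -coef_leading_poly p0 coef0.
apply/polyP => l; rewrite coef0 coef_leading_poly; apply/eqP.
by rewrite -pihomog_eq0_ideal_mul ?rees_coef.
Qed.

(** The choice of representative is harmless by [toric_pi], since [leading_poly] vanishes exactly on
    the fiber ideal. *)
Definition toric (x : F) : {poly R} := leading_poly (repr x).

Lemma toric_pi p : toric (\pi_F p) = leading_poly p.
Proof.
apply/eqP; rewrite -subr_eq0 -leading_polyB leading_poly_eq0.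
by rewrite Quotient.idealrBE reprK.
Qed.

Lemma toric_is_zmod_morphism : zmod_morphism toric.
Proof.
by elim/quotW=> p; elim/quotW=> q; rewrite -raddfB !toric_pi leading_polyB.
Qed.

Lemma toric_is_monoid_morphism : monoid_morphism toric.
Proof.
split; first by rewrite -(rmorph1 \pi_F) toric_pi leading_poly1.
by elim/quotW=> p; elim/quotW=> q; rewrite -rmorphM !toric_pi leading_polyM.
Qed.

HB.instance Definition _ :=
  GRing.isZmodMorphism.Build F {poly R} toric toric_is_zmod_morphism.
HB.instance Definition _ :=
  GRing.isMonoidMorphism.Build F {poly R} toric toric_is_monoid_morphism.

Lemma toric_inj : injective toric.
Proof.
apply: raddf_inj => u /eqP; rewrite /= /toric leading_poly_eq0 => u0.
by apply/eqP; rewrite -[u]reprK -(rmorph0 \pi_F) -Quotient.idealrBE subr0.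
Qed.

Lemma toricZ x (u : F) : toric (x *: u) = x%:MP *: toric u.
Proof.
have -> : x *: u = \pi_F (rees_const I x) * u by [].
by rewrite rmorphM /= toric_pi leading_poly_const mul_polyC.
Qed.

Lemma toric_coef u l : (toric u)`_l \in triform a b c K l.
Proof.
rewrite coef_leading_poly; apply: (leading_form_ideal_exp _ _ _ _ _ _ _).1.
exact: rees_coef.
Qed.

Lemma in_rees_monomial l (f : R) : f \in ideal_exp I l -> in_rees I (f *: 'X^l).
Proof.
move=> fI; apply/in_reesP => k; rewrite coefZ coefXn.
case: eqP => [->|_]; rewrite ?mulr1 // mulr0.
by case: (ideal_exp_is_ideal I k).
Qed.

Definition rees_monomial l f (fI : f \in ideal_exp I l) : rees I :=
  exist _ (f *: 'X^l) (in_rees_monomial l f fI).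

Lemma leading_poly_monomial l f (s : rees I) : val s = f *: 'X^l ->
  leading_poly s = pihomog mdeg (l * 3) f *: 'X^l.
Proof.
move=> sE; apply/polyP => k; rewrite coef_leading_poly sE !coefZ !coefXn.
by case: eqP => [->|_]; rewrite ?mulr1 // !mulr0 pihomog0.
Qed.

Lemma fiber_pieceP l (u : F) :
  reflect (exists2 f, f \in triform a b c K l & toric u = f *: 'X^l)
          (u \in fiber_piece I l).
Proof.
apply: (iffP (asboolP _)) => [[f [s [fI sE ->]]]|[f fl uE]].
  exists (pihomog mdeg (l * 3) f); first exact: (leading_form_ideal_exp _ _ _ _ _ _ _).1.
  by rewrite toric_pi (leading_poly_monomial _ _ _ sE).
have fI := triform_ideal_exp _ _ _ _ _ _ fl.
exists f, (rees_monomial l f fI); split=> //.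
apply: toric_inj; rewrite uE toric_pi (@leading_poly_monomial l f) //.
by rewrite triform_homog.
Qed.

Lemma ex_fiber_piece l (f : R) : f \in triform a b c K l ->
  exists u : F, toric u = f *: 'X^l.
Proof.
move=> fl; have fI := triform_ideal_exp _ _ _ _ _ _ fl.
exists (\pi_F (rees_monomial l f fI)).
by rewrite toric_pi (@leading_poly_monomial l f) // triform_homog.
Qed.

End ToricEmbedding.

(** * Binomial coefficients as polynomials *)

Section BinomialPolynomial.

Lemma prod_rising k r : (\prod_(i < r) (k + i.+1) * k`! = (k + r)`!)%N.
Proof.
elim: r => [|r IHr]; first by rewrite big_ord0 mul1n addn0.
by rewrite big_ord_recr /= addnS factS -IHr -addnS mulnAC mulnC.
Qed.

Lemma bin_rising k r : ('C(k + r, k) * r`! = \prod_(i < r) (k + i.+1))%N.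
Proof.
apply/eqP; rewrite -(eqn_pmul2r (fact_gt0 k)) prod_rising -mulnA [(r`! * _)%N]mulnC.
by rewrite -{2}[r](addKn k) bin_fact ?leq_addr.
Qed.

(** After multiplying by r!, compare factor by factor: k+i+1 is at most (k+1)(i+1). *)
Lemma bin_le_exp k r : ('C(k + r, k) <= k.+1 ^ r)%N.
Proof.
rewrite -(leq_pmul2r (fact_gt0 r)) bin_rising.
elim: r => [|r IHr]; first by rewrite big_ord0.
rewrite big_ord_recr /= factS expnSr.
have -> : (k.+1 ^ r * k.+1 * (r.+1 * r`!) = k.+1 ^ r * r`! * (k.+1 * r.+1))%N by lia.
by apply: leq_mul => //; lia.
Qed.

(** The factors X+i+1 are written as differences to match the lemmas on products of monic linear
    factors. *)
Definition bin_poly r : {poly rat} :=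
  (r`!%:R)^-1 *: \prod_(i < r) ('X - (- (i.+1)%:R)%:P).

Lemma fact_rat_neq0 r : r`!%:R != 0 :> rat.
Proof. by rewrite Num.Theory.pnatr_eq0 -lt0n fact_gt0. Qed.

Lemma size_bin_poly r : size (bin_poly r) = r.+1.
Proof.
rewrite size_scale ?invr_eq0 ?fact_rat_neq0 // size_prod_XsubC.
by rewrite -[index_enum _]enumT size_enum_ord.
Qed.

Lemma lead_coef_bin_poly r : lead_coef (bin_poly r) = (r`!%:R)^-1.
Proof. by rewrite lead_coefZ (eqP (monic_prod_XsubC _ _ _)) mulr1. Qed.

Lemma horner_bin_poly r k : (bin_poly r).[k%:R] = ('C(k + r, k))%:R.
Proof.
apply: (mulIf (fact_rat_neq0 r)); rewrite -natrM bin_rising hornerZ mulrAC.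
rewrite mulVf ?fact_rat_neq0 // mul1r horner_prod natr_prod.
by apply: eq_bigr => i _; rewrite !hornerE opprK natrD.
Qed.

End BinomialPolynomial.

(** * Prime kernels and substitutions killing variables *)

Section Kernels.
Variables (A : comNzRingType) (D : idomainType) (g : {rmorphism A -> D}).

Lemma kernel_idealr_closed : idealr_closed [pred u | g u == 0].
Proof.
split; rewrite ?inE ?rmorph0 ?rmorph1 ?oner_eq0 //.
by move=> x u v; rewrite !inE rmorphD rmorphM => /eqP-> /eqP->; rewrite mulr0 addr0.
Qed.

Lemma kernel_prime : prime_idealr_closed [pred u | g u == 0].
Proof. by move=> u v; rewrite !inE rmorphM mulf_eq0. Qed.

End Kernels.

Section Kill.
Variables (K : fieldType) (n : nat) (r : 'I_n -> nat).

Definition kill s : {mpoly K[n]} -> {mpoly K[n]} :=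
  comp_mpoly [tuple if (r i < s)%N then 0 else 'X_i | i < n].

HB.instance Definition _ s := GRing.RMorphism.on (kill s).

Lemma killX s i : kill s 'X_i = if (r i < s)%N then 0 else 'X_i.
Proof. by rewrite /kill comp_mpolyXU -tnth_nth tnth_mktuple. Qed.

Lemma kill_scale_mon s x m :
  kill s (x *: 'X_[m]) = x *: \prod_(i < n) kill s 'X_i ^+ m i.
Proof.
rewrite /kill comp_mpolyZ comp_mpolyX; congr (_ *: _).
by apply: eq_bigr => i _; rewrite comp_mpolyXU -tnth_nth.
Qed.

(** The later substitution also kills everything the earlier one did; this makes the kernels
    increase with the stage. *)
Lemma kill_kill s t f : (s <= t)%N -> kill t (kill s f) = kill t f.
Proof.
move=> le_st; rewrite [f]mpolyE [kill s _]raddf_sum [LHS]raddf_sum [RHS]raddf_sum.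
apply: eq_bigr => m _; rewrite /= !kill_scale_mon -!mul_mpolyC.
rewrite [LHS]rmorphM; congr (_ * _); first exact: comp_mpolyC.
rewrite [LHS]rmorph_prod; apply: eq_bigr => i _.
rewrite [LHS]rmorphXn /= !killX; case: ifP => [lt_is|_]; last by rewrite killX.
by rewrite [kill t 0]rmorph0 (leq_trans lt_is le_st).
Qed.

End Kill.

(** * Coordinates, graded dimensions and degree bounds *)

Section FiberRing.
Variables (K : fieldType) (a b c : nat).
Local Notation R := {mpoly K[a + b + c]}.
Local Notation I := (box_ideal K a b c).
Local Notation F := (fiber_ring I).
Local Notation toric := (toric K a b c).
Local Notation tri_mons := (tri_mons a b c).

Definition tcoef l m (u : F) : K := ((toric u)`_l)@_m.

Lemma tcoef_is_scalar l m : scalar (tcoef l m).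
Proof.
move=> x u v; rewrite /tcoef raddfD /= toricZ coefD coefZ mcoeffD.
by rewrite mcoeffCM.
Qed.

HB.instance Definition _ l m :=
  GRing.isLinear.Build K F K *%R (tcoef l m) (tcoef_is_scalar l m).

Lemma tcoef_eq0 u :
  (forall l m, tridegree a b c l m -> tcoef l m u = 0) -> u = 0.
Proof.
move=> u0; apply: (@toric_inj K a b c); rewrite raddf0; apply/polyP => l.
rewrite coef0; apply/mpolyP => m; rewrite mcoeff0.
have [/u0//|] := boolP (tridegree a b c l m).
by move: m; apply/triformP/toric_coef.
Qed.

Lemma has_dim_fiber_piece l : has_dim (fiber_piece I l) (size (tri_mons l)).
Proof.
pose mn (i : 'I_(size (tri_mons l))) := nth 0%MM (tri_mons l) i.
have mn_tri i : tridegree a b c l (mn i) by rewrite -mem_tri_mons mem_nth.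
have [v vE] := choice (fun i =>
  ex_fiber_piece K a b c l _ (triformX a b c K l _ (mn_tri i))).
have vC k m i : tcoef k m (v i) = ((k == l) && (mn i == m))%:R.
  rewrite /tcoef vE coefZ coefXn; case: eqP => _; last by rewrite mulr0 mcoeff0.
  by rewrite mulr1 mcoeffX.
have sumC k m (e : 'I_(size (tri_mons l)) -> K) : tcoef k m (\sum_i e i *: v i) =
    \sum_i e i * ((k == l) && (mn i == m))%:R.
  by rewrite linear_sum; apply: eq_bigr => i _; rewrite linearZ /= vC.
have sum_mn (e : 'I_(size (tri_mons l)) -> K) j :
    \sum_i e i * ((l == l) && (mn i == mn j))%:R = e j.
  rewrite (bigD1 j) //= !eqxx mulr1 big1 ?addr0 // => i iNj.
  by rewrite nth_uniq ?uniq_tri_mons // val_eqE (negPf iNj) andbF mulr0.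
exists v; split.
- move=> i; apply/fiber_pieceP; exists 'X_[mn i] => //; exact: triformX.
- by move=> e e0 j; have := sumC l (mn j) e; rewrite e0 linear0 sum_mn.
- move=> u /fiber_pieceP[f fl uE]; exists (fun i => tcoef l (mn i) u).
  apply/eqP; rewrite -subr_eq0; apply/eqP; apply: tcoef_eq0 => k m km.
  rewrite linearB /= sumC; have [kl|kNl] := eqVneq k l; last first.
    rewrite /= big1 => [|i _]; last by rewrite mulr0.
    by rewrite /tcoef uE coefZ coefXn (negPf kNl) mulr0 mcoeff0 subrr.
  move: km; rewrite kl -mem_tri_mons => /(nthP 0%MM)[j ltj <-].
  apply/eqP; rewrite subr_eq0 eq_sym; apply/eqP.
  by have := sum_mn (fun i => tcoef l (mn i) u) (Ordinal ltj); rewrite eqxx.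
Qed.

Definition tri_mons_upto k :=
  [seq (l, m) | l <- iota 0 k.+1, m <- tri_mons l].

(** Supplies [linear_relation] with finitely many functionals detecting zero in t-degree at most
    [k]. *)
Lemma tcoef_upto_eq0 k u : (size (toric u) <= k.+1)%N ->
  (forall lm, lm \in tri_mons_upto k -> tcoef lm.1 lm.2 u = 0) -> u = 0.
Proof.
move=> szu u0; apply: tcoef_eq0 => l m lm.
have [le_lk|lt_kl] := leqP l k; last first.
  by rewrite /tcoef nth_default ?mcoeff0 // (leq_trans szu).
apply: (u0 (l, m)); apply/allpairsPdep; exists l, m.
by rewrite mem_iota mem_tri_mons.
Qed.

Lemma size_toric_sum (T : finType) k (e : T -> K) (v : T -> F) :
  (forall t, size (toric (v t)) <= k)%N ->
  (size (toric (\sum_t e t *: v t)%R) <= k)%N.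
Proof.
move=> vk; rewrite raddf_sum; elim/big_ind: _ => [|p q pk qk|t _].
- by rewrite size_poly0.
- by rewrite (leq_trans (size_polyD _ _)) // geq_max pk.
- by rewrite /= toricZ (leq_trans (size_scale_leq _ _)).
Qed.

Lemma size_toric_expo_prod N n (x : nat -> F) s (e : expo N n) :
  (forall i, (i < n)%N -> size (toric (x i)) <= s.+1)%N ->
  (size (toric (expo_prod K F N n x e)) <= (n * (N * s)).+1)%N.
Proof.
elim: n x e => [|n IHn] x e xs /=; first by rewrite rmorph1 size_poly1.
rewrite rmorphM rmorphXn /=.
have szx : (size (toric (x 0%N) ^+ e.1) <= (N * s).+1)%N.
  apply: leq_trans (size_poly_exp_leq _ _) _; rewrite ltnS mulnC.
  by apply: leq_mul; [exact: ltnW | have := xs 0%N isT; case: (size _)].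
have := IHn (fun i => x i.+1) e.2 (fun i => xs i.+1).
have := size_polyMleq (toric (x 0%N) ^+ e.1)
  (toric (expo_prod K F N n (fun i => x i.+1) e.2)).
rewrite mulSn => szM szy; apply: (leq_trans szM); move: (leq_add szx szy).
by case: (_ + _)%N => [|k] /=; lia.
Qed.

End FiberRing.

(** * The Krull dimension *)

Section KrullDimension.
Variables (K : fieldType) (a b c : nat).
Local Notation I := (box_ideal K a.+1 b.+1 c.+1).
Local Notation F := (fiber_ring I).
Local Notation toric := (toric K a.+1 b.+1 c.+1).
Local Notation d := (a + b + c)%N.

Lemma size_tri_mons_le l : (size (tri_mons a.+1 b.+1 c.+1 l) <= l.+1 ^ d)%N.
Proof. by rewrite size_tri_mons !expnD !leq_mul ?bin_le_exp. Qed.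

Lemma size_tri_mons_upto k :
  (size (tri_mons_upto a.+1 b.+1 c.+1 k) <= k.+1 ^ d.+1)%N.
Proof.
rewrite size_allpairs_dep sumnE big_map.
apply: (@leq_trans (\sum_(l <- iota 0 k.+1) k.+1 ^ d)%N).
  rewrite big_seq [leqRHS]big_seq; apply: leq_sum => l.
  rewrite mem_iota add0n => ltlk; apply: leq_trans (size_tri_mons_le l) _.
  by case: d => // e; rewrite leq_exp2r.
by rewrite big_const_seq count_predT size_iota iter_addn_0 expnSr.
Qed.

Lemma prime_chain_le n (P : nat -> {pred F}) : prime_chain n P -> (n <= d.+1)%N.
Proof.
move=> chP; rewrite leqNgt; apply/negP => lt_dn.
have [x xP] : exists x : nat -> F,
    forall i, (i < n)%N -> x i \notin P i /\ x i \in P i.+1.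
  have ex i : exists u : F, (i < n)%N -> u \notin P i /\ u \in P i.+1.
    have [ltin|] := boolP (i < n)%N; last by exists 0.
    have [_ /(_ i ltin)[_ Psub]] := chP; apply: contrapT => noU.
    apply: Psub => u uP; apply: contrapT => /negP uNP.
    by apply: noU; exists u.
  by have [x xP] := choice ex; exists x.
pose s := \max_(i < n) size (toric (x i)).
have xs i : (i < n)%N -> (size (toric (x i)) <= s.+1)%N.
  by move=> ltin; apply/leqW/(leq_bigmax (Ordinal ltin)).
(* The N^n monomials with exponents below [N] have t-degree at most [k], where there are at most
   (k+1)^(d+1) coordinates. As k+1 <= N(ns+1), this is at most N^(d+1) (N-1), which is less than
   N^(d+2) <= N^n. *)
pose N := ((n * s).+1 ^ d.+1).+1; pose k := (n * (N * s))%N.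
have [] := @linear_relation K F (expo N n) (expo_prod K F N n x) _
  (fun j => tcoef K _ _ _ (tnth (in_tuple (tri_mons_upto a.+1 b.+1 c.+1 k)) j).1
               (tnth (in_tuple (tri_mons_upto a.+1 b.+1 c.+1 k)) j).2).
- rewrite card_expo; apply: leq_ltn_trans (size_tri_mons_upto k) _.
  apply: (@leq_trans (N ^ d.+2)); last by rewrite leq_pexp2l.
  have le_k : (k.+1 <= N * (n * s).+1)%N by rewrite /k; nia.
  have : (k.+1 ^ d.+1 <= (N * (n * s).+1) ^ d.+1)%N by rewrite leq_exp2r.
  move=> /leq_ltn_trans; apply.
  by rewrite expnMn [(N ^ d.+2)%N]expnSr ltn_pmul2l ?expn_gt0.
- move=> e e0; apply: (@tcoef_upto_eq0 _ _ _ _ k).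
    by apply: size_toric_sum => t; apply: size_toric_expo_prod.
  move=> lm /(nthP lm)[j ltj <-]; have := e0 (Ordinal ltj).
  by rewrite !(tnth_nth lm).
- move=> e [t et] sum0; move/negP: et; apply; apply/eqP.
  apply: (prime_chain_independent _ _ _ _ P x chP xP).
  by rewrite sum0; case: chP => /(_ 0%N isT)[[]].
Qed.

(* The last variables x_a, y_b, z_c survive until all others are killed; then *)
(* only x_a is, which already annihilates every x_i y_j z_k.                  *)
Definition kill_stage (t : 'I_(a.+1 + b.+1 + c.+1)) : nat :=
  match split t with
  | inl t' => match split t' with
              | inl i => if (i < a)%N then (i : nat) else d
              | inr j => if (j < b)%N then (a + j)%N else d.+1
              end
  | inr k => if (k < c)%N then (a + b + k)%N else d.+1
  end.

Definition kill_prime s : {pred F} :=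
  [pred u | map_poly (kill K _ kill_stage s) (toric u) == 0].

Lemma kill_prime_monomial s i j k (u : F) :
    toric u = 'X_[box_mon a.+1 b.+1 c.+1 i j k] *: 'X^1 ->
  (u \in kill_prime s) =
  [|| kill_stage (lshift _ (lshift _ i)) < s, kill_stage (lshift _ (rshift _ j)) < s
    | kill_stage (rshift _ k) < s]%N.
Proof.
move=> uE; rewrite inE uE map_polyZ map_polyXn /= -mul_polyC mulf_eq0 polyC_eq0.
rewrite (negPf (monic_neq0 (monicXn _ 1))) orbF !mpolyXD.
rewrite [kill _ _ _ _ _]rmorphM /= [kill _ _ _ _ (_ * _)]rmorphM /= !killX.
by do 3!case: ifP => _; rewrite ?(mul0r, mulr0) ?eqxx //;
  rewrite -!mpolyXD -msupp_eq0 msuppX.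
Qed.

(** A box monomial whose first killed variable has stage exactly [s] lies in [kill_prime s.+1] but
    not in [kill_prime s], so the inclusion is strict. *)
Lemma kill_stage_witness s : (s < d.+1)%N -> exists i j k,
  minn (kill_stage (lshift _ (lshift _ i)))
    (minn (kill_stage (lshift _ (rshift _ j))) (kill_stage (rshift _ k))) = s.
Proof.
move=> ltsd; rewrite /kill_stage.
(* Take the variable of stage [s] and complete it by last variables, whose stages are at least [d];
   for [s = d] all three are last. *)
exists (inord (if (s < a)%N then s else a)).
exists (inord (if (a <= s < a + b)%N then s - a else b)%N).
exists (inord (if (a + b <= s < d)%N then s - (a + b) else c)%N).
by rewrite !split_lshift !split_rshift !inordK; do ?case: ifP; lia.
Qed.

Lemma kill_prime_chain : prime_chain d.+1 kill_prime.
Proof.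
split=> [s _|s ltsd].
  split; first exact: kernel_idealr_closed (map_poly (kill K _ kill_stage s) \o toric).
  exact: kernel_prime (map_poly (kill K _ kill_stage s) \o toric).
split=> [u|].
  rewrite !inE => /eqP u0.
  have <- : map_poly (kill K _ kill_stage s.+1)
              (map_poly (kill K _ kill_stage s) (toric u)) =
            map_poly (kill K _ kill_stage s.+1) (toric u).
    by apply/polyP => l; rewrite !coef_map_id0 ?rmorph0 ?kill_kill.
  by rewrite u0 rmorph0.
have [i [j [k ijk]]] := kill_stage_witness s ltsd.
have [u uE] := ex_fiber_piece K _ _ _ 1 _
  (triformX _ _ _ K _ _ (tridegree_box _ _ _ i j k)).
move=> /(_ u); rewrite !(kill_prime_monomial _ i j k) //.
by lia.
Qed.

Lemma krull_dim_fiber_ring : krull_dim F d.+1.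
Proof.
split; first by exists kill_prime; apply: kill_prime_chain.
exact: prime_chain_le.
Qed.

End KrullDimension.

Theorem proposition4p2 (K : fieldType) (charK0 : [pchar K] =i pred0)
    (a b c : nat) (a_gt0 : (0 < a)%N) (b_gt0 : (0 < b)%N) (c_gt0 : (0 < c)%N) :
  has_multiplicity (A := fiber_ring (box_ideal K a b c))
    (fiber_piece (box_ideal K a b c))
    (((a + b + c - 3)`!)%:R / ((a - 1)`! * (b - 1)`! * (c - 1)`!)%:R).
Proof.
case: a b c a_gt0 b_gt0 c_gt0 {charK0} => [//|a] [//|b] [//|c] _ _ _.
have -> : (a.+1 + b.+1 + c.+1 - 3 = a + b + c)%N by lia.
(* The sides are now a+1, b+1, c+1, so a+b+c is the degree of the Hilbert polynomial, one less than
   the Krull dimension. *)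
rewrite !subn1 /=; exists (a + b + c)%N, (bin_poly a * bin_poly b * bin_poly c).
have bin_neq0 r : bin_poly r != 0 by rewrite -size_poly_eq0 size_bin_poly.
split.
- exact: krull_dim_fiber_ring.
- by rewrite !size_mul ?mulf_neq0 // !size_bin_poly !addnS.
- rewrite !lead_coefM !lead_coef_bin_poly !natrM [RHS]mulrAC divff ?fact_rat_neq0 //.
  by rewrite mul1r !invfM.
(* The Hilbert function agrees with its polynomial from degree 0 on. *)
- exists 0%N => k _; exists (size (tri_mons a.+1 b.+1 c.+1 k)).
    exact: has_dim_fiber_piece.
  by rewrite size_tri_mons !hornerM !horner_bin_poly !natrM.
Qed.
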